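(* There exist an absolute constant $\epsilon_0>0$ and a function $\eta:(0,\epsilon_0]\to[0,\infty)$ with $\eta(\epsilon)\to0$ as $\epsilon\to0$ such that for every $0<\epsilon\le\epsilon_0$ there exist a finite set $P_\epsilon\subset\mathbb{R}^4$ and a point $s\in P_\epsilon$ such that every $(1+\epsilon,\beta)$-shallow-light tree for $P_\epsilon$ rooted at $s$ (with respect to the Euclidean metric) has $\beta>\left(\frac{12}{11}-\eta(\epsilon)\right)\frac1\epsilon$.
   Context: For a finite point set $P\subset\mathbb{R}^d$, consider the complete graph on $P$ in which each edge $xy$ has weight $w(x,y)=\|x-y\|_2$. For a graph $H$ on $P$, $w(H)$ is the sum of its edge weights, and $\mathrm{dist}_H$ is the weighted shortest-path distance in $H$. Let $\mathrm{MST}(P)$ be a minimum-weight spanning tree of this complete graph. For $\alpha,\beta\ge 1$ and $s\in P$, an $(\alpha,\beta)$-shallow-light tree (SLT) for $P$ rooted at $s$ is a spanning tree $T$ of the complete graph on $P$ (no Steiner points) such that $\mathrm{dist}_T(s,t)\le\alpha\cdot w(s,t)$ for all $t\in P$, and $w(T)\le\beta\cdot w(\mathrm{MST}(P))$. *)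

(* Defs.v *)
From HB Require Import structures.
From mathcomp Require Import all_boot all_order all_algebra finmap.
From mathcomp Require Import all_classical all_reals all_analysis.

Set Implicit Arguments.
Unset Strict Implicit.
Unset Printing Implicit Defensive.

Import Order.TTheory GRing.Theory Num.Theory.
Import numFieldNormedType.Exports.

Local Open Scope classical_set_scope.
Local Open Scope ring_scope.

(* The library norm on 'rV[R]_d is the sup norm, hence this definition. *)
Definition eucl_norm (R : realType) (d : nat) (x : 'rV[R]_d) : R :=
  Num.sqrt (\sum_(i < d) x ord0 i ^+ 2).

Definition eucl_dist (R : realType) (d : nat) (P : {fset 'rV[R]_d}) (x y : P) : R :=
  eucl_norm (val x - val y).

(* A simple graph on V, i.e. a subgraph of the complete graph on V, is given by
   its adjacency relation. *)
Definition simple_graph (V : finType) (H : rel V) : Prop :=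
  symmetric H /\ irreflexive H.

Definition connected_graph (V : finType) (H : rel V) : Prop :=
  forall x y : V, connect H x y.

(* A closed walk x, y, x along one edge has size 2 and is not a cycle. *)
Definition acyclic_graph (V : finType) (H : rel V) : Prop :=
  forall c : seq V, ucycle H c -> (size c <= 2)%N.

Definition spanning_tree (V : finType) (H : rel V) : Prop :=
  [/\ simple_graph H, connected_graph H & acyclic_graph H].

Section WeightedGraphs.
Variables (R : realType) (V : finType) (w : V -> V -> R).

(* Each edge xy is met twice, as (x, y) and as (y, x); w is meant symmetric. *)
Definition graph_weight (H : rel V) : R :=
  2^-1 * \sum_(x : V) \sum_(y : V | H x y) w x y.

Definition path_weight (x : V) (p : seq V) : R :=
  \sum_(l <- pairmap w x p) l.

(* Equal to +oo when no path of H joins x to y. *)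
Definition graph_dist (H : rel V) (x y : V) : \bar R :=
  ereal_inf [set (path_weight x p)%:E | p in
    [set p : seq V | [/\ path H x p, uniq (x :: p) & last x p = y]]].

Definition minimum_spanning_tree (M : rel V) : Prop :=
  spanning_tree M /\
  forall H : rel V, spanning_tree H -> graph_weight M <= graph_weight H.

(* All minimum spanning trees have the same weight, so the choice of M is
   immaterial. *)
Definition shallow_light_tree (alpha beta : R) (s : V) (T : rel V) : Prop :=
  [/\ spanning_tree T,
      forall t : V, (graph_dist T s t <= (alpha * w s t)%:E)%E
    & exists2 M : rel V,
        minimum_spanning_tree M & graph_weight T <= beta * graph_weight M].

End WeightedGraphs.

(* Main.v *)
(* After rescaling, the root is the origin of R^4 and the leaves are points of
   the sphere of radius rho with mutual distances at least a, where eps * rho is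
   slightly smaller than a. A path to a leaf whose last edge comes from another
   leaf has length at least rho + a > (1 + eps) * rho. The leaves are the corners
   of nearly regular tetrahedra of edge a, and over the centre of each
   tetrahedron there is an apex at radius rho + h with h = 5 a / 16: then the
   legs from the apex to the corners have length about a - h = 11 a / 16, and a
   path to a leaf through an apex is again at least (rho + h) + (a - h) long. So
   a shallow-light tree contains the edge from the root to every leaf.
   Consecutive tetrahedra of a chain share a corner, so each of them adds three
   leaves, i.e. 3 rho to the weight of the shallow-light tree, but only
   4 * 11 a / 16 = 11 a / 4 to the weight of a spanning tree; the ratio is
   3 rho / (11 a / 4), about (12 / 11) / eps. The chains are drawn in the
   face-centred cubic lattice and lifted to a small spherical cap: with
   x = eps^(1/4), taking L = x^-3 chains of L tetrahedra makes the weight of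
   order x^-6, which dominates the distance rho of order x^-4 to the root, while
   the diameter L of the cap is small against rho. *)
Require Import Defs.
From HB Require Import structures.
From mathcomp Require Import all_boot all_order all_algebra finmap.
From mathcomp Require Import all_classical all_reals all_analysis.
From mathcomp Require Import zify ring lra.

Set Implicit Arguments.
Unset Strict Implicit.
Unset Printing Implicit Defensive.

Import Order.TTheory GRing.Theory Num.Theory.
Import numFieldNormedType.Exports.

Local Open Scope classical_set_scope.
Local Open Scope ring_scope.

(** * Euclidean distance *)

(** Cauchy-Schwarz: with [A], [B] the two norms, the nonnegative sum of the squares of
    [a i * B - b i * A] is [2 * (A * B)] times the gap between the two sides. *)
Lemma sum_prod_le_sqrt (R : rcfType) (I : finType) (a b : I -> R) :
  \sum_i a i * b i <= Num.sqrt (\sum_i a i ^+ 2) * Num.sqrt (\sum_i b i ^+ 2).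
Proof.
have sq_ge0 (f : I -> R) : 0 <= \sum_i f i ^+ 2 by apply: sumr_ge0 => i _; exact: sqr_ge0.
set A := Num.sqrt _; set B := Num.sqrt _.
have A2 : A ^+ 2 = \sum_i a i ^+ 2 by rewrite sqr_sqrtr.
have B2 : B ^+ 2 = \sum_i b i ^+ 2 by rewrite sqr_sqrtr.
have A0 : 0 <= A := sqrtr_ge0 _.
have B0 : 0 <= B := sqrtr_ge0 _.
have zero_sum (f g : I -> R) : \sum_i f i ^+ 2 = 0 -> \sum_i f i * g i = 0.
  move=> /eqP; rewrite psumr_eq0 => [/allP f0|i _]; last exact: sqr_ge0.
  apply: big1 => i _; have := f0 i (mem_index_enum _).
  by rewrite implyTb sqrf_eq0 => /eqP ->; rewrite mul0r.
have [A00|A_neq0] := eqVneq A 0.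
  by rewrite zero_sum ?A00 ?mul0r // -A2 A00 expr0n.
have [B00|B_neq0] := eqVneq B 0.
  under eq_bigr do rewrite mulrC.
  by rewrite zero_sum ?B00 ?mulr0 // -B2 B00 expr0n.
have AB_gt0 : 0 < A * B by rewrite mulr_gt0 // lt_def ?A_neq0 ?B_neq0.
have := sq_ge0 (fun i => a i * B - b i * A).
have -> : \sum_i (a i * B - b i * A) ^+ 2 =
    2 * (A * B) * (A * B - \sum_i a i * b i).
  transitivity (B ^+ 2 * \sum_i a i ^+ 2 + A ^+ 2 * \sum_i b i ^+ 2
                - 2 * (A * B) * \sum_i a i * b i).
    rewrite !mulr_sumr -big_split -sumrB /=.
    by apply: eq_bigr => i _; ring.
  by rewrite -A2 -B2; ring.
by rewrite pmulr_rge0 ?subr_ge0 // mulr_gt0.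
Qed.

Lemma eucl_norm_ge0 (R : realType) (d : nat) (x : 'rV[R]_d) : 0 <= eucl_norm x.
Proof. exact: sqrtr_ge0. Qed.

Lemma eucl_norm0 (R : realType) (d : nat) : eucl_norm (0 : 'rV[R]_d) = 0.
Proof.
by rewrite /eucl_norm big1 ?sqrtr0 // => i _; rewrite mxE expr0n.
Qed.

Lemma eucl_normN (R : realType) (d : nat) (x : 'rV[R]_d) :
  eucl_norm (- x) = eucl_norm x.
Proof.
by congr Num.sqrt; apply: eq_bigr => i _; rewrite mxE sqrrN.
Qed.

Lemma ler_eucl_normD (R : realType) (d : nat) (x y : 'rV[R]_d) :
  eucl_norm (x + y) <= eucl_norm x + eucl_norm y.
Proof.
have sq_ge0 (z : 'rV[R]_d) : 0 <= \sum_i z ord0 i ^+ 2.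
  by apply: sumr_ge0 => i _; exact: sqr_ge0.
rewrite -(@ler_pXn2r _ 2) // ?nnegrE ?addr_ge0 ?eucl_norm_ge0 //.
rewrite sqrrD !sqr_sqrtr //.
have -> : \sum_i (x + y) ord0 i ^+ 2 = \sum_i x ord0 i ^+ 2 +
    (\sum_i x ord0 i * y ord0 i) *+ 2 + \sum_i y ord0 i ^+ 2.
  rewrite -sumrMnl -!big_split /=.
  by apply: eq_bigr => i _; rewrite mxE sqrrD.
by rewrite lerD2r lerD2l lerMn2r sum_prod_le_sqrt.
Qed.

Section EuclDist.
Variables (R : realType) (d : nat) (P : {fset 'rV[R]_d}).
Implicit Types x y z : P.

Lemma eucl_dist_ge0 x y : 0 <= eucl_dist x y.
Proof. exact: eucl_norm_ge0. Qed.

Lemma eucl_distxx x : eucl_dist x x = 0.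
Proof. by rewrite /eucl_dist subrr eucl_norm0. Qed.

Lemma eucl_distC x y : eucl_dist x y = eucl_dist y x.
Proof. by rewrite /eucl_dist -eucl_normN opprB. Qed.

Lemma eucl_dist_triangle x y z :
  eucl_dist x z <= eucl_dist x y + eucl_dist y z.
Proof.
rewrite /eucl_dist (_ : val x - val z = (val x - val y) + (val y - val z)).
  exact: ler_eucl_normD.
by rewrite addrA subrK.
Qed.

End EuclDist.

(** * Trees in finite metric spaces *)

Section Metric.
Variables (R : realType) (V : finType) (w : V -> V -> R).
Hypothesis w_ge0 : forall x y, 0 <= w x y.
Hypothesis wxx : forall x, w x x = 0.
Hypothesis wC : forall x y, w x y = w y x.
Hypothesis w_triangle : forall x y z, w x z <= w x y + w y z.

Lemma path_weight_cat x p q :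
  path_weight w x (p ++ q) = path_weight w x p + path_weight w (last x p) q.
Proof. by rewrite /path_weight pairmap_cat big_cat. Qed.

Lemma path_weight_ge x p : w x (last x p) <= path_weight w x p.
Proof.
elim: p x => [|y p IHp] x; first by rewrite /path_weight /= big_nil wxx.
rewrite /path_weight /= big_cons (le_trans (w_triangle x y _)) //.
by rewrite lerD2l; exact: IHp.
Qed.

(* The last edge u--t of a path from s to t either starts at s or makes the
   path too long. *)
Lemma root_edge_of_far (H : rel V) (s t : V) (b B : R) :
  s != t -> irreflexive H ->
  (forall u, u != s -> u != t -> B <= w s u + w u t) -> b < B ->
  (graph_dist w H s t <= b%:E)%E -> H s t.
Proof.
move=> st irrH far bB dist_le; apply: contraT => nHst.
suff : (B%:E <= graph_dist w H s t)%E.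
  by move=> /le_trans/(_ dist_le); rewrite lee_fin leNgt bB.
apply: le_ereal_inf_tmp => _ [p [pathp _ lastp] <-]; rewrite lee_fin.
case/lastP: p pathp lastp => [|p v]; first by move=> _ /eqP; rewrite (negbTE st).
rewrite rcons_path last_rcons => /andP[_ Huv] vt; rewrite vt in Huv *.
rewrite -cats1 path_weight_cat.
have -> : path_weight w (last s p) [:: t] = w (last s p) t.
  by rewrite /path_weight /= big_seq1.
apply: (le_trans (far (last s p) _ _)).
- by apply: contraNneq nHst => <-.
- by apply: contraTneq Huv => ->; rewrite irrH.
- by rewrite lerD2r path_weight_ge.
Qed.

(** The double sum meets the edge from [s] to [t] in the row of [s] and again in the row of [t],
    which makes up for the factor 1/2. *)
Lemma graph_weight_star (H : rel V) (s : V) (A : {set V}) :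
  symmetric H -> s \notin A -> (forall t, t \in A -> H s t) ->
  \sum_(t in A) w s t <= graph_weight w H.
Proof.
move=> symH sA Hs; rewrite /graph_weight.
set S := \sum_(t in A) w s t.
have le1 : S <= \sum_(y | H s y) w s y.
  rewrite /S [leRHS]big_mkcond [leLHS]big_mkcond /=; apply: ler_sum => t _.
  by case: ifP => [/Hs ->|_] //; case: ifP.
have le2 : S <= \sum_(x | x != s) \sum_(y | H x y) w x y.
  rewrite /S [leRHS]big_mkcond [leLHS]big_mkcond /=; apply: ler_sum => t _.
  have inner_ge0 : 0 <= \sum_(y | H t y) w t y by apply: sumr_ge0.
  case: ifP => [tA|_]; last by case: ifP.
  rewrite ifT; last by apply: contraNneq sA => <-.
  rewrite (bigD1 s) /=; last by rewrite symH Hs.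
  by rewrite wC lerDl sumr_ge0.
by rewrite ler_pdivlMl // mulr_natl mulr2n (bigD1 s) //= lerD.
Qed.

(** The value of [par] at the root [r] is ignored, so a total function describes the tree. *)
Definition parent_graph (r : V) (par : V -> V) : rel V :=
  fun x y => (x != r) && (par x == y) || (y != r) && (par y == x).

(** Only an inequality: two vertices that are each other's parent give one edge but two terms. *)
Lemma parent_graph_weight (r : V) (par : V -> V) :
  graph_weight w (parent_graph r par) <= \sum_(v | v != r) w v (par v).
Proof.
set S := \sum_(v | v != r) _; rewrite /graph_weight ler_pdivrMl // mulr_natl mulr2n.
pose e x y := (x != r) && (par x == y).
have sum_e : \sum_x \sum_(y | e x y) w x y = S.
  rewrite /S [RHS]big_mkcond; apply: eq_bigr => x _ /=; rewrite /e.
  case: ifP => _ /=; last by rewrite big_pred0_eq.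
  by rewrite (big_pred1 (par x)) // => y; rewrite eq_sym.
rewrite -{1}sum_e -[X in _ + X]sum_e [X in _ + X](exchange_big_dep predT) //=.
rewrite -big_split; apply: ler_sum => x _ /=.
rewrite [leLHS]big_mkcond [X in X + _]big_mkcond [X in _ + X]big_mkcond -big_split.
apply: ler_sum => y _ /=; rewrite /parent_graph -!/(e _ _) (wC y x).
by case: (e x y); case: (e y x) => /=; rewrite ?addr0 ?add0r ?lerDl.
Qed.

(** As the rank drops along [par], the ancestors of any vertex end at [r], and of the two ends of an
    edge the lower one is the parent of the other. *)
Lemma parent_graph_spanning_tree (r : V) (par : V -> V) (rk : V -> nat) :
  (forall v, v != r -> (rk (par v) < rk v)%N) ->
  spanning_tree (parent_graph r par).
Proof.
move=> rk_par; set H := parent_graph r par.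
have symH : symmetric H by move=> x y; rewrite /H /parent_graph orbC.
have parP x y : H x y -> (rk y <= rk x)%N -> y = par x.
  case/orP => /andP[nr /eqP]; first by [].
  by move=> <-; rewrite leqNgt rk_par.
split; first split=> // x.
- by rewrite /H /parent_graph orbb; apply: contraTF isT => /andP[/rk_par + /eqP xx];
    rewrite xx ltnn.
- have to_root x : connect H x r.
    have [n] := ubnP (rk x); elim: n x => // n IHn x; rewrite ltnS => le_n.
    have [->|xr] := eqVneq x r; first exact: connect0.
    apply: (connect_trans (y := par x)).
      by apply: connect1; rewrite /H /parent_graph xr eqxx.
    by apply: IHn; apply: leq_trans le_n; exact: rk_par.
  move=> x y; apply: connect_trans (to_root x) _.
  by rewrite (sym_connect_sym symH).
- (* both neighbours on a cycle of its vertex of maximal rank are its parent *)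
  move=> [|x0 c0] // cyc; set c := x0 :: c0 in cyc *.
  have x0c : x0 \in c by rewrite mem_head.
  case: (arg_maxnP rk x0c) => x xc x_max.
  have [i c' rot_c] := rot_to xc.
  have := cyc; rewrite /ucycle -(rot_cycle i) -(rot_uniq i) rot_c => /andP[].
  have size_c : size c = (size c').+1 by rewrite -(size_rot i) rot_c.
  have c'c y : y \in c' -> (rk y <= rk x)%N.
    move=> yc'; apply: x_max; change (y \in c).
    by rewrite -(mem_rot i) rot_c inE yc' orbT.
  rewrite size_c; case: c' {rot_c size_c} c'c => [|y c'] // c'c.
  case/lastP: c' c'c => [|c' z] // c'c /=.
  rewrite rcons_path last_rcons => /andP[Hxy /andP[_ Hzx]] /and3P[_ + _].
  rewrite mem_rcons inE negb_or => /andP[+ _].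
  rewrite (parP x y Hxy); last by apply: c'c; rewrite mem_head.
  rewrite (parP x z) ?eqxx //; first by rewrite symH.
  by apply: c'c; rewrite inE mem_rcons mem_head orbT.
Qed.

Lemma slt_weight_le (alpha beta : R) (s : V) (T H : rel V) :
  0 <= beta -> shallow_light_tree w alpha beta s T -> spanning_tree H ->
  graph_weight w T <= beta * graph_weight w H.
Proof.
move=> beta_ge0 [_ _ [M [_ minM] leT]] treeH.
by apply: (le_trans leT); rewrite ler_wpM2l // minM.
Qed.

End Metric.

(** * Lifting to the sphere *)

Definition row4 (R : realType) (a b c e : R) : 'rV[R]_4 :=
  \row_j nth 0 [:: a; b; c; e] j.

Lemma row4B (R : realType) (a b c e a' b' c' e' : R) :
  row4 a b c e - row4 a' b' c' e' = row4 (a - a') (b - b') (c - c') (e - e').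
Proof.
by apply/rowP => -[[|[|[|[|j]]]] lt_j4] //; rewrite !mxE.
Qed.

Lemma eucl_norm_row4 (R : realType) (a b c e : R) :
  eucl_norm (row4 a b c e) ^+ 2 = a ^+ 2 + b ^+ 2 + c ^+ 2 + e ^+ 2.
Proof.
rewrite sqr_sqrtr; last by apply: sumr_ge0 => i _; exact: sqr_ge0.
by rewrite !big_ord_recl big_ord0 !mxE /= addr0 !addrA.
Qed.

Lemma row4_inj (R : realType) (a b c e a' b' c' e' : R) :
  row4 a b c e = row4 a' b' c' e' -> [/\ a = a', b = b', c = c' & e = e'].
Proof.
move=> eq_rows.
have eqj (j : 'I_4) : nth 0 [:: a; b; c; e] j = nth 0 [:: a'; b'; c'; e'] j.
  by have := congr1 (fun r : 'rV[R]_4 => r ord0 j) eq_rows; rewrite !mxE.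
by split; [exact: (eqj (@Ordinal 4 0 isT)) | exact: (eqj (@Ordinal 4 1 isT))
          | exact: (eqj (@Ordinal 4 2 isT)) | exact: (eqj (@Ordinal 4 3 isT))].
Qed.

Definition sq3 (R : realType) (x y z : R) : R := x ^+ 2 + y ^+ 2 + z ^+ 2.

(* The point above (x, y, z) on the upper half of the sphere of radius rho
   centred at 0, scaled by k. *)
Definition lift (R : realType) (rho k x y z : R) : 'rV[R]_4 :=
  row4 (k * x) (k * y) (k * z) (k * Num.sqrt (rho ^+ 2 - sq3 x y z)).

Section Lift.
Variables (R : realType) (rho k l x y z x' y' z' : R).
Hypothesis (rho_ge0 : 0 <= rho) (k_ge0 : 0 <= k) (l_ge0 : 0 <= l).
Hypothesis le_rho : sq3 x y z <= rho ^+ 2.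
Hypothesis le_rho' : sq3 x' y' z' <= rho ^+ 2.

Lemma eucl_norm_lift : eucl_norm (lift rho k x y z) = k * rho.
Proof.
apply/eqP; rewrite -(@eqrXn2 _ 2) ?eucl_norm_ge0 ?mulr_ge0 // eucl_norm_row4.
rewrite !exprMn sqr_sqrtr ?subr_ge0 // /sq3; apply/eqP; ring.
Qed.

(** For vectors p, q of equal norm [rho], |k p - l q|^2 = (k - l)^2 rho^2 + k l |p - q|^2; here |p -
    q|^2 is split into its flat part and its height part. *)
Lemma lift_dist_sqr :
  eucl_norm (lift rho k x y z - lift rho l x' y' z') ^+ 2 =
    (k - l) ^+ 2 * rho ^+ 2 + k * l * (sq3 (x - x') (y - y') (z - z') +
      (Num.sqrt (rho ^+ 2 - sq3 x y z) - Num.sqrt (rho ^+ 2 - sq3 x' y' z')) ^+ 2).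
Proof.
rewrite row4B eucl_norm_row4.
have := sqr_sqrtr (_ : 0 <= rho ^+ 2 - sq3 x y z).
have := sqr_sqrtr (_ : 0 <= rho ^+ 2 - sq3 x' y' z').
rewrite !subr_ge0 => /(_ le_rho') + /(_ le_rho).
set t := Num.sqrt (_ - sq3 x y z); set t' := Num.sqrt _ => t2' t2.
have E : rho ^+ 2 = t ^+ 2 + sq3 x y z by rewrite t2 subrK.
have E' : rho ^+ 2 = t' ^+ 2 + sq3 x' y' z' by rewrite t2' subrK.
transitivity (k * (k - l) * (t ^+ 2 + sq3 x y z) -
              l * (k - l) * (t' ^+ 2 + sq3 x' y' z') +
  k * l * (sq3 (x - x') (y - y') (z - z') + (t - t') ^+ 2)).
  by rewrite /sq3; ring.
by rewrite -E -E'; ring.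
Qed.

Lemma lift_dist_ge :
  (k - l) ^+ 2 * rho ^+ 2 + k * l * sq3 (x - x') (y - y') (z - z') <=
    eucl_norm (lift rho k x y z - lift rho l x' y' z') ^+ 2.
Proof.
by rewrite lift_dist_sqr lerD2l ler_wpM2l ?mulr_ge0 // lerDl sqr_ge0.
Qed.

(** For the heights [t], [t'], the product [(t + t') * (t - t')] is up to sign a difference of flat
    squared norms, hence at most |p - p'| |p + p'|. Since [t + t'] is large, the height part is at
    most [kappa] times the flat squared distance. *)
Lemma lift_dist_le (D kappa : R) :
  sq3 x y z <= D -> sq3 x' y' z' <= D -> D < rho ^+ 2 ->
  D <= kappa * (rho ^+ 2 - D) ->
  eucl_norm (lift rho k x y z - lift rho l x' y' z') ^+ 2 <=
    (k - l) ^+ 2 * rho ^+ 2 + k * l * ((1 + kappa) * sq3 (x - x') (y - y') (z - z')).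
Proof.
move=> leD leD' D_lt kappaP.
rewrite lift_dist_sqr lerD2l ler_wpM2l ?mulr_ge0 // mulrDl mul1r lerD2l.
have := sqr_sqrtr (_ : 0 <= rho ^+ 2 - sq3 x y z).
have := sqr_sqrtr (_ : 0 <= rho ^+ 2 - sq3 x' y' z').
rewrite !subr_ge0 => /(_ le_rho') + /(_ le_rho).
have := sqrtr_ge0 (rho ^+ 2 - sq3 x y z).
have := sqrtr_ge0 (rho ^+ 2 - sq3 x' y' z').
set t := Num.sqrt (_ - sq3 x y z); set t' := Num.sqrt _ => t'_ge0 t_ge0 t2' t2.
set N := sq3 (x - x') _ _.
have N_ge0 : 0 <= N by rewrite /N /sq3 !addr_ge0 ?sqr_ge0.
have D_gt0 : 0 < 4 * (rho ^+ 2 - D) by lra.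
rewrite -(ler_pM2l D_gt0).
have sum_ge : 4 * (rho ^+ 2 - D) <= (t + t') ^+ 2.
  have m_ge0 : 0 <= rho ^+ 2 - D by lra.
  have le_t u : 0 <= u -> rho ^+ 2 - D <= u ^+ 2 -> Num.sqrt (rho ^+ 2 - D) <= u.
    by move=> u0 le_u; rewrite -(ger0_norm u0) -sqrtr_sqr ler_wsqrtr.
  have := le_t t t_ge0; have := le_t t' t'_ge0.
  rewrite t2 t2' => /(_ ltac:(lra)) le1 /(_ ltac:(lra)) le2.
  have := sqr_sqrtr m_ge0; have := sqrtr_ge0 (rho ^+ 2 - D).
  move: le1 le2; set m := Num.sqrt _ => le1 le2 m0 <-; nra.
apply: (@le_trans _ _ ((t + t') ^+ 2 * (t - t') ^+ 2)).
  by rewrite ler_wpM2r ?sqr_ge0.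
have -> : (t + t') ^+ 2 * (t - t') ^+ 2 = (sq3 x y z - sq3 x' y' z') ^+ 2.
  transitivity ((t ^+ 2 - t' ^+ 2) ^+ 2); first by ring.
  by rewrite t2 t2'; ring.
apply: (@le_trans _ _ (N * sq3 (x + x') (y + y') (z + z'))).
  (* Cauchy-Schwarz, in the form of Lagrange's identity *)
  rewrite -subr_ge0 /N /sq3; set e := _ - _.
  have -> : e =
    ((x - x') * (y + y') - (y - y') * (x + x')) ^+ 2 +
    ((x - x') * (z + z') - (z - z') * (x + x')) ^+ 2 +
    ((y - y') * (z + z') - (z - z') * (y + y')) ^+ 2 by rewrite /e; ring.
  by rewrite !addr_ge0 ?sqr_ge0.
apply: (@le_trans _ _ (N * (4 * D))).
  rewrite ler_wpM2l //.
  have : sq3 (x + x') (y + y') (z + z') <= 2 * sq3 x y z + 2 * sq3 x' y' z'.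
    rewrite /sq3; have := sqr_ge0 (x - x'); have := sqr_ge0 (y - y').
    have := sqr_ge0 (z - z'); lra.
  by lra.
have : N * D <= N * (kappa * (rho ^+ 2 - D)) by rewrite ler_wpM2l.
by lra.
Qed.

End Lift.

(** * Chains of tetrahedra *)

(* Cell (i, j) carries a tetrahedron with apex over its centre; the flags
   (false, false), (true, false), (false, true) are its first three vertices,
   (true, true) is its apex, and its fourth vertex is the first vertex of the
   cell (i + 1, j). *)
Definition cell (L : nat) : finType := ('I_L * 'I_L * (bool * bool))%type.

Definition apex (L : nat) (u : cell L) : bool := u.2.1 && u.2.2.

Section Coordinates.
Variables (R : realType) (L : nat).
Implicit Types u v : cell L.

(** Cell (i, j) fills the unit cube with least corner (i, i, 2j). The tetrahedron has the alternate
    corners (0, 0, 0), (1, 0, 1), (0, 1, 1), (1, 1, 0) of the cube, so its edges are face diagonals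
    of length sqrt 2; the chains run along x = y. *)
Definition xcrd u : R := u.1.1%:R + (if apex u then 2^-1 else u.2.1%:R).
Definition ycrd u : R := u.1.1%:R + (if apex u then 2^-1 else u.2.2%:R).
Definition zcrd u : R :=
  (2 * u.1.2)%:R + (if apex u then 2^-1 else (u.2.1 (+) u.2.2)%:R).

Definition crd_dist u v : R :=
  sq3 (xcrd u - xcrd v) (ycrd u - ycrd v) (zcrd u - zcrd v).

(** The first two coordinates are at most [L] and the third at most [2 * L]; 1 + 1 + 4 = 6. *)
Lemma crd_bound u : sq3 (xcrd u) (ycrd u) (zcrd u) <= 6 * L%:R ^+ 2.
Proof.
have frac (b c : bool) : 0 <= (if b then 2^-1 else c%:R : R) <= 1.
  by case: b; [lra | rewrite ler0n lern1 leq_b1].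
have bnd (m n : nat) (q : R) :
    0 <= q <= 1 -> (m < n)%N -> (m%:R + q) ^+ 2 <= n%:R ^+ 2.
  move=> /andP[q0 q1] ltmn; have := ler0n R m => m0.
  rewrite ler_pXn2r ?nnegrE ?addr_ge0 //.
  by apply: le_trans (_ : m.+1%:R <= _); rewrite ?ler_nat // -natr1 lerD2l.
have [lti ltj] := (ltn_ord u.1.1, ltn_ord u.1.2).
have lt2j : (2 * u.1.2 < 2 * L)%N by lia.
have := bnd _ _ _ (frac (apex u) u.2.1) lti.
have := bnd _ _ _ (frac (apex u) u.2.2) lti.
have := bnd _ _ _ (frac (apex u) (u.2.1 (+) u.2.2)) lt2j.
by rewrite (natrM _ 2 L) exprMn -/(xcrd u) -/(ycrd u) -/(zcrd u) /sq3; lra.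
Qed.

(* The vertices lie in the lattice of integer points with even coordinate sum. *)
Lemma leaf_sep u v : ~~ apex u -> ~~ apex v -> u != v -> 2 <= crd_dist u v.
Proof.
case: u v => [[i j] [b1 b2]] [[i' j'] [c1 c2]].
rewrite /crd_dist /sq3 /xcrd /ycrd /zcrd /apex /= => nb nc.
rewrite (negbTE nb) (negbTE nc) => ne.
pose dx : int := (i + b1)%N%:Z - (i' + c1)%N%:Z.
pose dy : int := (i + b2)%N%:Z - (i' + c2)%N%:Z.
pose dz : int := (2 * j + (b1 (+) b2))%N%:Z - (2 * j' + (c1 (+) c2))%N%:Z.
have castB (m n m' n' : nat) :
    m%:R + n%:R - (m'%:R + n'%:R) = ((m + n)%N%:Z - (m' + n')%N%:Z)%:~R :> R.
  by rewrite rmorphB /= -!pmulrn !natrD.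
rewrite !castB -/dx -/dy -/dz -!rmorphXn -!rmorphD /= (_ : 2 = 2%:~R) // ler_int.
have {}ne : (dx != 0) || (dy != 0) || (dz != 0).
  apply: contraNT ne; rewrite !negb_or !negbK /dx /dy /dz => /andP[/andP[x0 y0] z0].
  have [ei ej] : (i = i' :> nat) /\ (j = j' :> nat) /\ b1 = c1 /\ b2 = c2.
    by clear -nb nc x0 y0 z0; move: b1 b2 c1 c2 nb nc x0 y0 z0 => [] [] [] [] //=; lia.
  move: ej => [ej [-> ->]].
  by rewrite (val_inj ei : i = i') (val_inj ej : j = j').
have [e ee] : exists e : int, dx + dy + dz = 2 * e.
  exists ((dx + dy + dz) %/ 2)%Z.
  by rewrite /dx /dy /dz; clear -nb nc; move: b1 b2 c1 c2 nb nc => [] [] [] [] //=; lia.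
(* If the squares add up to less than 2, exactly one difference is nonzero and it is 1 or -1, so the
   sum of the three is odd. *)
move: dx dy dz ne ee => dx dy dz ne ee; rewrite leNgt; apply/negP => lt2.
have bound (d : int) : d ^+ 2 < 2 -> - 1 <= d <= 1 by rewrite expr2; nia.
have sq0 (d : int) : 0 <= d ^+ 2 by exact: sqr_ge0.
have [xb yb zb] : [/\ - 1 <= dx <= 1, - 1 <= dy <= 1 & - 1 <= dz <= 1].
  by split; apply: bound; move: (sq0 dx) (sq0 dy) (sq0 dz) lt2; lia.
rewrite !expr2 in lt2; nia.
Qed.

(* Each coordinate difference is a half-integer. *)
Lemma apex_sep u v : apex u -> ~~ apex v -> 3 / 4 <= crd_dist u v.
Proof.
case: u v => [[i j] [b1 b2]] [[i' j'] [c1 c2]].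
rewrite /crd_dist /sq3 /xcrd /ycrd /zcrd /apex /= => -> /negbTE ->.
have half (m n p : nat) : 1 / 4 <= (m%:R + 2^-1 - (n%:R + p%:R)) ^+ 2 :> R.
  rewrite -natrD; case: (leqP (n + p) m) => [le|lt].
    have : (n + p)%:R <= m%:R :> R by rewrite ler_nat.
    by move: (n + p)%:R => q; nra.
  have : m%:R + 1 <= (n + p)%:R :> R by rewrite natr1 ler_nat.
  by move: (n + p)%:R => q; nra.
have := half i i' c1; have := half i i' c2; have := half (2 * j)%N (2 * j')%N (c1 (+) c2).
lra.
Qed.

End Coordinates.

(** * A spanning tree along the chains *)

Definition ord_down (n : nat) (i : 'I_n) : 'I_n :=
  Ordinal (leq_ltn_trans (leq_pred i) (ltn_ord i)).

(* None stands for the root. *)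
Definition parent (L : nat) (v : option (cell L)) : option (cell L) :=
  if v is Some (i, j, (b1, b2)) then
    if b1 && b2 then Some (i, j, (false, false))
    else if b1 || b2 then Some (i, j, (true, true))
    else if i != 0 :> nat then Some (ord_down i, j, (true, true))
    else if j != 0 :> nat then Some (i, ord_down j, (false, false))
    else None
  else None.

(** A rank for [parent]. The factor 2 outweighs the extra 1 of an apex, from which the first vertex
    of the next cell hangs. *)
Definition level (L : nat) (v : option (cell L)) : nat :=
  if v is Some (i, j, (b1, b2)) then
    ((2 * i + j).+1 + (if b1 && b2 then 1 else if b1 || b2 then 2 else 0))%N
  else 0.

Lemma level_parent (L : nat) (v : option (cell L)) :
  v != None -> (level (parent v) < level v)%N.
Proof.
case: v => [[[i j] [b1 b2]]|] // _ /=.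
case: b1 b2 => [] [] /=; try lia.
by case: ifP => [i0|_] /=; [lia | case: ifP => [j0|_] /=; lia].
Qed.

Definition tetra_pt (R : realType) (L : nat) (rho h : R) (v : option (cell L)) :
    'rV[R]_4 :=
  if v is Some u then
    lift rho (if apex u then 1 + h / rho else 1) (xcrd R u) (ycrd R u) (zcrd R u)
  else 0.

Definition leaf (L : nat) (v : option (cell L)) : bool :=
  if v is Some u then ~~ apex u else false.

(** The start of a chain: its parent is the start of the previous chain or, for [origin], the
    root. *)
Definition row_start (L : nat) (u : cell L) : bool :=
  (u.1.1 == 0 :> nat) && ~~ (u.2.1 || u.2.2).

Definition origin (L : nat) (u : cell L) : bool := row_start u && (u.1.2 == 0 :> nat).

Lemma big_some (R : Type) (idx : R) (op : Monoid.com_law idx) (T : finType)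
    (P : pred (option T)) (F : option T -> R) : ~~ P None ->
  \big[op/idx]_(v | P v) F v = \big[op/idx]_(u | P (Some u)) F (Some u).
Proof.
move=> nP; rewrite (reindex_omap Some id) => [|[u|]] //; last by rewrite (negbTE nP).
by apply: eq_bigl => u; rewrite eqxx andbT.
Qed.

(** * Distances and weights in the configuration *)

Section Configuration.
(** [kappa] bounds the relative growth of squared distances under the lift, and [ell] the length of
    a leg from an apex to a corner. *)
Variables (R : realType) (L : nat) (rho a h kappa ell : R).
Hypothesis rho_gt0 : 0 < rho.
Hypothesis a_gt0 : 0 < a.
Hypothesis a_sqr : a ^+ 2 = 2.
Hypothesis h_def : h = 5 / 16 * a.
Hypothesis L_rho : 6 * L%:R ^+ 2 < rho ^+ 2.
Hypothesis kappa_ge0 : 0 <= kappa.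
Hypothesis kappaP : 6 * L%:R ^+ 2 <= kappa * (rho ^+ 2 - 6 * L%:R ^+ 2).
Hypothesis kappa_le : 4 * (1 + kappa) <= 9.
Hypothesis ell_ge0 : 0 <= ell.
Hypothesis ellP : h ^+ 2 + (1 + h / rho) * ((1 + kappa) * (3 / 4)) <= ell ^+ 2.

Local Notation pt := (@tetra_pt R L rho h).
Local Notation W := (fun u v : option (cell L) => eucl_norm (pt u - pt v)).

Let h_gt0 : 0 < h. Proof. by rewrite h_def mulr_gt0. Qed.

Let scale_ge0 (b : bool) : 0 <= if b then 1 + h / rho else 1.
Proof. by case: b => //; rewrite addr_ge0 // divr_ge0 // ltW. Qed.

Let crd_rho (u : cell L) : sq3 (xcrd R u) (ycrd R u) (zcrd R u) <= rho ^+ 2.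
Proof. exact: le_trans (crd_bound R u) (ltW L_rho). Qed.

Let scaleB : ((1 + h / rho) - 1) ^+ 2 * rho ^+ 2 = h ^+ 2.
Proof. by field; rewrite gt_eqF. Qed.

Lemma norm_tetra_pt (u : cell L) :
  eucl_norm (pt (Some u)) = if apex u then rho + h else rho.
Proof.
rewrite eucl_norm_lift ?(ltW rho_gt0) ?scale_ge0 ?crd_rho //.
by case: ifP => _; [field; rewrite gt_eqF | rewrite mul1r].
Qed.

Lemma leaf_leaf_dist (u v : cell L) :
  ~~ apex u -> ~~ apex v -> u != v -> a <= W (Some u) (Some v).
Proof.
move=> nu nv uv; rewrite -(@ler_pXn2r _ 2) ?nnegrE ?eucl_norm_ge0 ?(ltW a_gt0) //.
apply: le_trans (lift_dist_ge _ _ _ _);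
  rewrite ?scale_ge0 ?crd_rho // a_sqr.
rewrite (negbTE nu) (negbTE nv) subrr expr0n /= mul0r add0r !mul1r.
exact: leaf_sep.
Qed.

(* Here [(a - h) ^+ 2 = h ^+ 2 + 3 / 4]. *)
Lemma apex_leaf_dist (u v : cell L) :
  apex u -> ~~ apex v -> a - h <= W (Some u) (Some v).
Proof.
move=> au nv; rewrite -(@ler_pXn2r _ 2) ?nnegrE ?eucl_norm_ge0 //; last first.
  by rewrite h_def; have := a_gt0; lra.
apply: le_trans (lift_dist_ge _ _ _ _);
  rewrite ?scale_ge0 ?crd_rho ?(ltW rho_gt0) //.
rewrite au (negbTE nv) scaleB mulr1.
(* This fixes the constant 5/16: with [a ^+ 2 = 2] it is the solution of
   [a ^+ 2 - 2 * a * h = 3 / 4]. *)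
have : (a - h) ^+ 2 = h ^+ 2 + 3 / 4.
  by rewrite (_ : 3 / 4 = 3 / 8 * a ^+ 2) ?h_def; [field | rewrite a_sqr; lra].
move=> ->; rewrite lerD2l -/(crd_dist R u v).
have := apex_sep R au nv; have : 0 < h / rho by rewrite divr_gt0.
by set N := crd_dist _ _ _; set q := h / rho; nra.
Qed.

Lemma leaf_far (u t : option (cell L)) :
  leaf t -> u != None -> u != t -> rho + a <= W None u + W u t.
Proof.
case: t u => [t|] // [u|] //= nt _ ut.
rewrite sub0r eucl_normN -/(pt (Some u)) norm_tetra_pt.
case: (boolP (apex u)) => [au|nu].
  by have := apex_leaf_dist au nt; rewrite /= au (negbTE nt); lra.
have := leaf_leaf_dist nu nt; rewrite /= (negbTE nu) (negbTE nt) lerD2l.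
by apply; apply: contraNneq ut => ->.
Qed.

(** The norms 0, [rho] and [rho + h] tell root, leaves and apexes apart; leaves are separated by
    distance, apexes by their coordinates. *)
Lemma tetra_pt_inj : injective pt.
Proof.
have norm_gt0 (u : cell L) : 0 < eucl_norm (pt (Some u)).
  by rewrite norm_tetra_pt; case: ifP => _ //; rewrite addr_gt0.
move=> [u|] [v|] // eq_uv; last 2 first.
- by have := norm_gt0 u; rewrite eq_uv /= eucl_norm0 ltxx.
- by have := norm_gt0 v; rewrite -eq_uv /= eucl_norm0 ltxx.
have same_apex : apex u = apex v.
  have := congr1 (@eucl_norm R 4) eq_uv; rewrite !norm_tetra_pt.
  by case: (apex u); case: (apex v) => //; have := h_gt0; lra.
congr Some; case: (boolP (apex u)) => [au|nu]; last first.
  apply/eqP; apply: contraTT isT => uv.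
  have nv : ~~ apex v by rewrite -same_apex.
  have := leaf_leaf_dist nu nv uv.
  by rewrite eq_uv subrr eucl_norm0 leNgt a_gt0.
have av : apex v by rewrite -same_apex.
case: (row4_inj eq_uv); rewrite au av => eqx _ eqz _.
have k_neq0 : 1 + h / rho != 0 by rewrite gt_eqF // addr_gt0 // divr_gt0.
move: (mulfI k_neq0 eqx) (mulfI k_neq0 eqz); rewrite /xcrd /zcrd au av.
move=> /addIr/eqP + /addIr/eqP; rewrite !eqr_nat => /eqP ei /eqP ej {eq_uv eqx eqz}.
case: u v ei ej au av {same_apex} => [[i j] [b1 b2]] [[i' j'] [c1 c2]] /=.
move=> ei ej /andP[/= -> ->] /andP[/= -> ->].
have ej' : j = j' :> nat by lia.
by rewrite (val_inj ei : i = i') (val_inj ej' : j = j').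
Qed.

Lemma apex_leg (u v : cell L) :
  apex u -> ~~ apex v -> crd_dist R u v = 3 / 4 -> W (Some u) (Some v) <= ell.
Proof.
move=> au nv duv; rewrite -(@ler_pXn2r _ 2) ?nnegrE ?eucl_norm_ge0 //.
apply: le_trans ellP; apply: le_trans (lift_dist_le _ _ _ _ (crd_bound R u)
  (crd_bound R v) L_rho kappaP) _;
  rewrite ?scale_ge0 ?crd_rho ?(ltW rho_gt0) //.
by rewrite au (negbTE nv) scaleB mulr1 -/(crd_dist R u v) duv.
Qed.

(** Every parent edge is a leg, except at the chain starts; [ell] is still charged there to keep the
    later sum uniform. *)
Lemma parent_dist (u : cell L) :
  W (Some u) (parent (Some u)) <=
    ell + (if row_start u then 3 else 0) + (if origin u then rho else 0).
Proof.
case: u => [[i j] [b1 b2]].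
have start_ge0 : 0 <= (if row_start (i, j, (b1, b2)) then 3 else 0 : R) by case: ifP.
have origin_ge0 : 0 <= (if origin (i, j, (b1, b2)) then rho else 0 : R).
  by case: ifP => // _; exact: ltW.
case: (boolP (b1 && b2)) => b12.
  rewrite /parent b12 -addrA ler_wpDr ?addr_ge0 //.
  apply: apex_leg => //; rewrite /crd_dist /xcrd /ycrd /zcrd /apex /= b12 /sq3 /=.
  by field.
have distC (v w : option (cell L)) : W v w = W w v by rewrite -eucl_normN opprB.
case: (boolP (b1 || b2)) => b12'.
  rewrite /parent (negbTE b12) b12' -addrA ler_wpDr ?addr_ge0 // distC.
  apply: apex_leg => //.
  rewrite /crd_dist /xcrd /ycrd /zcrd /apex /= (negbTE b12) /sq3 /=.
  by case: b1 b2 b12 b12' {start_ge0 origin_ge0} => [] [] //= _ _; field.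
move: b12 b12' start_ge0 origin_ge0; case: b1 b2 => [] [] // _ _ s0 o0.
rewrite [parent _]/=; case: ifPn => i0.
  rewrite -addrA ler_wpDr ?addr_ge0 // distC.
  apply: apex_leg => //.
  rewrite /crd_dist /xcrd /ycrd /zcrd /apex /= /sq3 /=.
  have -> : i%:R = i.-1%:R + 1 :> R by rewrite natr1 prednK // lt0n.
  by field.
rewrite negbK in i0.
have start : row_start (i, j, (false, false)) by rewrite /row_start /= i0.
have -> : origin (i, j, (false, false)) = (j == 0 :> nat) by rewrite /origin start.
rewrite start.
case: ifPn => j0; last first.
  rewrite negbK in j0; rewrite j0 [pt None]/= subr0.
  by rewrite norm_tetra_pt lerDr addr_ge0.
(* Consecutive chain starts are 2 apart before lifting, and [4 * (1 + kappa) <= 9] keeps them within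
   3. *)
rewrite (negbTE j0) addr0 ler_wpDl //.
rewrite -(@ler_pXn2r _ 2) ?nnegrE ?eucl_norm_ge0 //.
apply: le_trans (lift_dist_le _ _ _ _ (crd_bound R _) (crd_bound R _) L_rho kappaP) _;
  rewrite ?scale_ge0 ?crd_rho ?(ltW rho_gt0) //.
rewrite /= /sq3 /xcrd /ycrd /zcrd /apex /=.
have -> : (2 * j)%:R = (2 * j.-1)%:R + 2 :> R.
  by rewrite -natrD; congr (_%:R); move: j0; lia.
by have := kappa_le; set q := (2 * _)%:R; nra.
Qed.

(** There are [4 * L ^ 2] points besides the root, at most [L] chain starts and at most one
    origin. *)
Lemma parent_dist_sum :
  \sum_(v | v != None) W v (parent v) <= 4 * L%:R ^+ 2 * ell + 3 * L%:R + rho.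
Proof.
rewrite big_some //.
apply: le_trans; first by apply: ler_sum => u _; exact: parent_dist.
rewrite !big_split /= -!big_mkcond /= !sumr_const !lerD //.
- rewrite !card_prod card_bool !card_ord -[ell *+ _]mulr_natl !natrM.
  by rewrite le_eqVlt; apply/orP; left; apply/eqP; ring.
- rewrite -[leLHS]mulr_natr ler_wpM2l // ler_nat.
  rewrite -[leqRHS]card_ord -(@card_in_imset _ _ (fun u : cell L => u.1.2)) ?max_card //.
  move=> [[i j] [b1 b2]] [[i' j'] [c1 c2]]; rewrite !unfold_in /row_start /=.
  move=> /andP[/eqP i0 /norP[/negbTE-> /negbTE->]].
  move=> /andP[/eqP i0' /norP[/negbTE-> /negbTE->]] ->.
  by rewrite (val_inj (etrans i0 (esym i0')) : i = i').
- rewrite -[leRHS]mulr1n ler_wpMn2l ?(ltW rho_gt0) //.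
  apply/card_le1_eqP => -[[i j] [b1 b2]] [[i' j'] [c1 c2]].
  rewrite !unfold_in /origin /row_start /=.
  move=> /andP[/andP[/eqP i0 /norP[/negbTE-> /negbTE->]] /eqP j0].
  move=> /andP[/andP[/eqP i0' /norP[/negbTE-> /negbTE->]] /eqP j0'].
  by rewrite (val_inj (etrans i0 (esym i0')) : i = i')
             (val_inj (etrans j0 (esym j0')) : j = j').
Qed.

Lemma card_leaf : #|[pred v : option (cell L) | leaf v]| = (3 * L ^ 2)%N.
Proof.
rewrite -sum1_card big_some //.
rewrite big_mkcond /=.
transitivity (\sum_(ij : 'I_L * 'I_L) \sum_(b : bool * bool) if ~~ (b.1 && b.2) then 1 else 0)%N.
  by rewrite pair_bigA.
under eq_bigr do rewrite -(pair_bigA _ (fun b1 b2 : bool => if ~~ (b1 && b2) then 1 else 0)%N)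
  /= !big_bool /=.
by rewrite sum_nat_const card_prod !card_ord; lia.
Qed.

(** As [alpha * rho < rho + a], the detours of [leaf_far] are too long, so [T] contains the star
    from the root to all leaves; the tree of [parent] bounds the minimum spanning tree from
    above. *)
Lemma tetra_slt_weight :
  exists (P : {fset 'rV[R]_4}) (s : P), forall (alpha beta : R) (T : rel P),
    0 <= beta -> alpha * rho < rho + a ->
    shallow_light_tree (@eucl_dist R 4 P) alpha beta s T ->
    3 * L%:R ^+ 2 * rho <= beta * (4 * L%:R ^+ 2 * ell + 3 * L%:R + rho).
Proof.
(* The bijection [g] from indices to points, with inverse [g'], moves all computations to
   [option (cell L)]. *)
pose P : {fset 'rV[R]_4} := [fset pt v | v in {: option (cell L)}]%fset.
have inP v : pt v \in P by rewrite in_imfset.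
pose g v : P := FSetSub (inP v).
have g_inj : injective g by move=> u v /(congr1 val) /tetra_pt_inj.
have g_surj (x : P) : exists v, g v = x.
  by have /imfsetP[v _ xv] := valP x; exists v; apply: val_inj.
have [g' g'K] := choice g_surj.
have gK : cancel g g' by move=> v; apply: g_inj; rewrite g'K.
have dist_g u v : eucl_dist (g u) (g v) = W u v by [].
exists P, (g None) => alpha beta T beta_ge0 alpha_lt slt.
have [[[symT irrT] _ _] dist_le _] := slt.
pose A : {set P} := finset (fun x => leaf (g' x)).
have root_leaf t : leaf t -> W None t = rho.
  case: t => [t|] //= nt; rewrite sub0r eucl_normN -/(pt (Some t)).
  by rewrite norm_tetra_pt (negbTE nt).
have edge t : t \in A -> T (g None) t.
  rewrite inE -{2}(g'K t); move: (g' t) => {}t leaf_t.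
  apply: (root_edge_of_far (@eucl_distxx R 4 P) (@eucl_dist_triangle R 4 P)
    (b := alpha * rho) (B := rho + a)) => //.
  - by rewrite (inj_eq g_inj); case: t leaf_t.
  - move=> u; rewrite -(g'K u) !(inj_eq g_inj) !dist_g => un ut.
    exact: leaf_far.
  - by rewrite -(root_leaf t leaf_t) -dist_g; exact: dist_le.
have nA : g None \notin A by rewrite inE gK.
have := graph_weight_star (@eucl_dist_ge0 R 4 P) (@eucl_distC R 4 P) symT nA edge.
have -> : \sum_(t in A) eucl_dist (g None) t = 3 * L%:R ^+ 2 * rho.
  rewrite (eq_bigr (fun=> rho)) => [|t]; last first.
    by rewrite inE -{2}(g'K t) dist_g; exact: root_leaf.
  have -> : A = (g @: [pred v : option (cell L) | leaf v])%SET.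
    apply/setP => x; rewrite inE; apply/idP/imsetP => [leaf_x|[v leaf_v ->]].
      by exists (g' x); rewrite ?g'K.
    by rewrite gK.
  by rewrite sumr_const card_imset // card_leaf -[LHS]mulr_natl natrM natrX.
move=> /le_trans -> //; pose par x := g (parent (g' x)).
have tree : spanning_tree (parent_graph (g None) par).
  apply: (parent_graph_spanning_tree (rk := fun x => level (g' x))) => x.
  rewrite -{1}(g'K x) (inj_eq g_inj) /par gK; exact: level_parent.
apply: le_trans (slt_weight_le beta_ge0 slt tree) _; rewrite ler_wpM2l //.
apply: le_trans (parent_graph_weight (@eucl_dist_ge0 R 4 P) (@eucl_distC R 4 P) _ _) _.
apply: le_trans parent_dist_sum; rewrite (reindex g); last by exists g' => x _.
rewrite le_eqVlt; apply/orP; left; apply/eqP.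
by apply: eq_big => [v|v _]; rewrite ?(inj_eq g_inj) // /par gK.
Qed.

End Configuration.

(** * The ratio of the weights *)

(** By contradiction: a smaller [beta] would give 3 <= (12/11 - 12x)(1 + x)(11/4)(1 + 2x), whose
    right side is 3 - 24x plus negative terms. *)
Lemma slt_ratio_bound (R : realFieldType) (x a l rho beta : R) :
  0 < x <= 1 / 100 -> 0 < a -> a ^+ 2 = 2 -> 0 < rho ->
  rho * (x ^+ 4 * (1 + x)) = a -> 0 < l -> l * x ^+ 3 <= 1 < (l + 1) * x ^+ 3 ->
  1 <= beta ->
  3 * l ^+ 2 * rho <=
    beta * (4 * l ^+ 2 * (11 / 16 * a * (1 + x)) + 3 * l + rho) ->
  (12 / 11 - 12 * x) * (1 / x ^+ 4) < beta.
Proof.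
move=> /andP[x0 x_le] a0 a2 rho0 rho_def l0 /andP[u_le u_gt] beta1 le_beta.
have x3 : x ^+ 3 <= 1 / 100.
  have x2 : x ^+ 2 <= 1 by nra.
  by rewrite exprS; nra.
have a1 : 1 <= a by nra.
have x4_gt0 : 0 < x ^+ 4 by rewrite exprn_gt0.
rewrite mul1r ltr_pdivrMr // ltNge; apply/negP => le_q.
have q0 : 0 < 12 / 11 - 12 * x by lra.
set q := 12 / 11 - 12 * x in le_q q0.
(* Multiplied by [x ^+ 6], the left side is of order at most [x ^+ 2] and the right side of order
   [x], as [l * x ^+ 3] is close to 1. *)
have small : 3 * l + rho <= 11 / 4 * (a * l ^+ 2 * x).
  have x6_gt0 : 0 < x ^+ 6 by rewrite exprn_gt0.
  rewrite -(ler_pM2l x6_gt0).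
  set u := l * x ^+ 3 in u_le u_gt.
  have -> : x ^+ 6 * (3 * l + rho) = 3 * u * x ^+ 3 + rho * x ^+ 4 * x ^+ 2.
    by rewrite /u; ring.
  have -> : x ^+ 6 * (11 / 4 * (a * l ^+ 2 * x)) = 11 / 4 * (a * u ^+ 2 * x).
    by rewrite /u; field.
  have u_ge : 9 / 10 <= u by rewrite /u; lra.
  have u2 : 1 / 2 <= u ^+ 2 by nra.
  have r4 : rho * x ^+ 4 <= a.
    by rewrite -rho_def mulrA ler_peMr ?lerDl ?mulr_ge0 ?(ltW rho0) ?(ltW x4_gt0) ?(ltW x0).
  have t1 : rho * x ^+ 4 * x ^+ 2 <= a * x ^+ 2 by rewrite ler_wpM2r ?sqr_ge0.
  have t2 : 3 * u * x ^+ 3 <= 3 * x ^+ 3 by nra.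
  have t3 : a * (x * (1 / 2)) <= a * (x * u ^+ 2).
    by rewrite ler_pM2l // ler_pM2l.
  have t4 : 3 * x ^+ 3 <= 3 * x ^+ 2 by rewrite (exprS x 2); nra.
  have t5 : x ^+ 2 <= a * x ^+ 2 by rewrite ler_peMl ?sqr_ge0.
  have t6 : a * x ^+ 2 <= a * (x / 100) by rewrite ler_pM2l // expr2; nra.
  have t7 : 0 < a * x by rewrite mulr_gt0.
  lra.
have B_le : 4 * l ^+ 2 * (11 / 16 * a * (1 + x)) + 3 * l + rho <=
    11 / 4 * (1 + 2 * x) * (a * l ^+ 2) by lra.
set B := _ + rho in le_beta B_le.
have B0 : 0 <= B by rewrite /B !addr_ge0 ?mulr_ge0 ?sqr_ge0; lra.
have al0 : 0 < a * l ^+ 2 by rewrite mulr_gt0 ?exprn_gt0.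
have k0 : 0 < x ^+ 4 * (1 + x) by rewrite mulr_gt0 //; lra.
(* Multiplying by [x ^+ 4 * (1 + x)] turns [rho] into [a] and [beta * x ^+ 4] into at most [q]. *)
have main : 3 * (a * l ^+ 2) <=
    q * (1 + x) * (11 / 4 * (1 + 2 * x)) * (a * l ^+ 2).
  have -> : 3 * (a * l ^+ 2) = x ^+ 4 * (1 + x) * (3 * l ^+ 2 * rho).
    by rewrite -[in LHS]rho_def; ring.
  apply: (@le_trans _ _ (x ^+ 4 * (1 + x) * (beta * B))); first by rewrite ler_pM2l.
  apply: (@le_trans _ _ (q * (1 + x) * B)).
    rewrite (_ : _ * (beta * B) = beta * x ^+ 4 * (1 + x) * B); last by ring.
    by rewrite ler_wpM2r // ler_wpM2r //; lra.
  rewrite -[leRHS]mulrA ler_wpM2l // mulr_ge0 //; lra.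
rewrite ler_pM2r // in main.
have : q * (1 + x) * (11 / 4 * (1 + 2 * x)) =
    3 - 24 * x - 93 * x ^+ 2 - 66 * x ^+ 3 by rewrite /q; field.
move: main => + e; rewrite {}e.
have : 0 < x ^+ 3 by rewrite exprn_gt0.
have := sqr_ge0 x; lra.
Qed.

(** * Choice of the parameters *)

Lemma sqrt_sqrt_cvg0 (R : realType) :
  12 * Num.sqrt (Num.sqrt x) @[x --> (0 : R)^'+] --> (0 : R).
Proof.
apply: cvg_at_right_filter.
rewrite -[X in _ --> X](_ : 12 * Num.sqrt (Num.sqrt 0) = 0 :> R); last first.
  by rewrite !sqrtr0 mulr0.
apply: cvgM; first exact: cvg_cst.
by apply: continuous_comp; exact: sqrt_continuous.
Qed.

Theorem theorem1p4 (R : realType) :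
  exists (eps0 : R) (eta : R -> R),
    [/\ 0 < eps0,
        forall eps : R, 0 < eps <= eps0 -> 0 <= eta eps,
        eta x @[x --> (0 : R)^'+] --> (0 : R)
      & forall eps : R, 0 < eps <= eps0 ->
          exists (P : {fset 'rV[R]_4}) (s : P),
            forall (beta : R) (T : rel P), 1 <= beta ->
              shallow_light_tree (@eucl_dist R 4 P) (1 + eps) beta s T ->
              (12 / 11 - eta eps) * (1 / eps) < beta].
Proof.
(* With x = eps^(1/4), these say x <= 1/100 and eta = 12 x. *)
exists ((1 / 100) ^+ 4), (fun eps => 12 * Num.sqrt (Num.sqrt eps)); split.
- by rewrite exprn_gt0 //; lra.
- by move=> eps _; rewrite mulr_ge0 ?sqrtr_ge0.
- exact: sqrt_sqrt_cvg0.
move=> eps /andP[eps0 eps_le]; set x : R := Num.sqrt (Num.sqrt eps).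
have x0 : 0 < x by rewrite !sqrtr_gt0.
have x4 : x ^+ 4 = eps.
  by rewrite (exprM x 2 2) !sqr_sqrtr ?sqrtr_ge0 // ltW.
rewrite -x4 in eps_le *; clear eps0 x4; move: x x0 eps_le => {eps} x x0.
rewrite ler_pXn2r ?nnegrE ?(ltW x0) //.
move=> x_le; have x4_gt0 : 0 < x ^+ 4 by rewrite exprn_gt0.
have x3_gt0 : 0 < x ^+ 3 by rewrite exprn_gt0.
pose L := Num.truncn (x ^+ 3)^-1; pose l : R := L%:R.
have /andP[l_le l_gt] : l <= (x ^+ 3)^-1 < l + 1.
  by rewrite /l natr1; apply: truncn_itv; rewrite invr_ge0 ltW.
rewrite -[leRHS]mul1r ler_pdivlMr // in l_le.
rewrite -[ltLHS]mul1r ltr_pdivrMr // in l_gt.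
have x3_le : x ^+ 3 <= 1 / 100.
  have x2 : x ^+ 2 <= 1 by nra.
  by rewrite exprS; nra.
have l0 : 0 < l by rewrite -(pmulr_lgt0 _ x3_gt0); lra.
pose a : R := Num.sqrt 2.
have a0 : 0 < a by rewrite sqrtr_gt0.
have a2 : a ^+ 2 = 2 by rewrite sqr_sqrtr.
have k0 : 0 < x ^+ 4 * (1 + x) by rewrite mulr_gt0 //; lra.
(* Then eps * rho = a / (1 + x) is strictly below [a], as the strict bound on [alpha * rho]
   requires. *)
pose rho := a / (x ^+ 4 * (1 + x)).
have rho0 : 0 < rho by rewrite divr_gt0.
have rho_def : rho * (x ^+ 4 * (1 + x)) = a by rewrite /rho divfK // gt_eqF.
have l2_gt0 : 0 < 6 * l ^+ 2 by rewrite mulr_gt0 ?exprn_gt0.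
(* The distortion [kappa] is taken to be [x]: [l ^+ 2] is of order x^-6, while [x * rho ^+ 2] is of
   order x^-7. *)
have kappaP : 6 * l ^+ 2 <= x * (rho ^+ 2 - 6 * l ^+ 2).
  rewrite mulrBr lerBrDr.
  have k7 : 0 < x ^+ 7 * (1 + x) ^+ 2 by rewrite mulr_gt0 ?exprn_gt0 //; lra.
  rewrite -(ler_pM2r k7).
  have -> : x * rho ^+ 2 * (x ^+ 7 * (1 + x) ^+ 2) =
      (rho * (x ^+ 4 * (1 + x))) ^+ 2 by ring.
  have -> : (6 * l ^+ 2 + x * (6 * l ^+ 2)) * (x ^+ 7 * (1 + x) ^+ 2) =
      6 * (l * x ^+ 3) ^+ 2 * (x * (1 + x) ^+ 3) by ring.
  rewrite rho_def a2.
  have u2 : (l * x ^+ 3) ^+ 2 <= 1 by rewrite expr_le1 // ltW // mulr_gt0.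
  have c3 : (1 + x) ^+ 3 <= 2.
    apply: (@le_trans _ _ ((5 / 4) ^+ 3)); last by lra.
    by rewrite ler_pXn2r ?nnegrE //; lra.
  have : x * (1 + x) ^+ 3 <= 1 / 100 * 2.
    by rewrite ler_pM // ?exprn_ge0 ?(ltW x0) //; lra.
  have : 0 <= x * (1 + x) ^+ 3 by rewrite mulr_ge0 ?exprn_ge0 ?(ltW x0) //; lra.
  set c := x * _; set u := _ ^+ 2 in u2 *; have : 0 <= u by exact: sqr_ge0.
  nra.
have L_rho : 6 * l ^+ 2 < rho ^+ 2.
  rewrite -subr_gt0 -(pmulr_rgt0 _ x0); exact: lt_le_trans kappaP.
have kappa_le : 4 * (1 + x) <= 9 by lra.
have ell0 : 0 <= 11 / 16 * a * (1 + x) by rewrite !mulr_ge0 //; lra.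
(* For x = 0 both sides would be 121/128; the factor [(1 + x) ^+ 2] on the right absorbs the
   distortion and the radial scaling. *)
have ellP : (5 / 16 * a) ^+ 2 + (1 + 5 / 16 * a / rho) * ((1 + x) * (3 / 4)) <=
    (11 / 16 * a * (1 + x)) ^+ 2.
  have -> : 5 / 16 * a / rho = 5 / 16 * (x ^+ 4 * (1 + x)).
    by rewrite -[in LHS]rho_def; field; rewrite gt_eqF.
  have c_le : 5 / 16 * (x ^+ 4 * (1 + x)) <= x / 10.
    by rewrite (exprS x 3); nra.
  rewrite !exprMn a2; set c := 5 / 16 * (x ^+ 4 * _) in c_le *; nra.
have [P [s sltP]] := tetra_slt_weight rho0 a0 a2 erefl L_rho (ltW x0) kappaP
  kappa_le ell0 ellP.
exists P, s => beta T beta1 slt.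
apply: (slt_ratio_bound _ a0 a2 rho0 rho_def l0) => //; rewrite ?x0 ?l_le //.
apply: sltP slt; first by lra.
by have := mulr_gt0 (mulr_gt0 rho0 x4_gt0) x0; move: rho_def; rewrite -/a; lra.
Qed.
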